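(* Let $(V,E)$ be a connected graph, let $\mathcal{M}^I\subseteq V$, $\mathcal{M}^P\subseteq V$, and let real costs $c^I_i$ ($i\in\mathcal{M}^I$), $c^P_k$ ($k\in\mathcal{M}^P$) be given. Then the integer program (DOM) defined in the context is equivalent to the mixed integer linear program (DOM-MIP) obtained from it by relaxing the variables $x$ and $w$ to be continuous, namely $0\le x_i\le1$ for $i\in\mathcal{M}^I$ and $0\le w_{ij}\le1$ for $i,j\in V$, while keeping $z_k\in\{0,1\}$ for $k\in\mathcal{M}^P$ and all other constraints: (DOM) is feasible if and only if (DOM-MIP) is feasible, and the two programs have the same optimal value.
   Context: Graphs are finite and undirected; edges are unordered pairs of two nodes. Integer program (DOM): minimize $\sum_{i\in\mathcal{M}^I}c^I_ix_i+\sum_{k\in\mathcal{M}^P}c^P_kz_k$ over $x_i$ ($i\in V$), $z_k$ ($k\in V$), $w_{ij}$ ($i,j\in V$), subject to: 1. $z_i+\sum_{k:\{i,k\}\in E}z_k+\sum_{j\in V}w_{ij}\ge1$ for all $i\in V$; 2. $\sum_{i\in V}w_{ij}\le x_j$ for all $j\in V$; 3. $w_{ij}=0$ for all $i\ne j$ with $\{i,j\}\notin E$; 4. $\sum_{k\in\mathcal{M}^P}z_k\ge1$; 5. $x_i=0$ for $i\notin\mathcal{M}^I$ and $z_k=0$ for $k\notin\mathcal{M}^P$; 6. $x_i\in\{0,1\}$ for $i\in\mathcal{M}^I$, $z_k\in\{0,1\}$ for $k\in\mathcal{M}^P$, $w_{ij}\in\{0,1\}$ for $i,j\in V$. *)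

(* Defs.v *)
From HB Require Import structures.
From mathcomp Require Import all_boot all_order all_algebra.
From mathcomp Require Import classical_sets reals constructive_ereal ereal.

Set Implicit Arguments.
Unset Strict Implicit.
Unset Printing Implicit Defensive.

Import Order.TTheory GRing.Theory Num.Theory.
Local Open Scope ring_scope.

(* A graph on V is given by its edge set E : {set {set V}}; every edge consists
   of exactly two nodes, so [set i; i] is never an edge. *)
Definition is_graph (V : finType) (E : {set {set V}}) : Prop :=
  forall e : {set V}, e \in E -> #|e| = 2%N.

Definition adj (V : finType) (E : {set {set V}}) : rel V :=
  fun i j => [set i; j] \in E.

Definition connected_graph (V : finType) (E : {set {set V}}) : Prop :=
  is_graph E /\ forall i j : V, connect (adj E) i j.

Record dom_vars (R : realType) (V : finType) := DomVars {
  xvar : V -> R;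
  zvar : V -> R;
  wvar : V -> V -> R
}.

(* The costs cI and cP are total functions, but only their values on MI and MP
   are used. *)
Definition dom_cost (R : realType) (V : finType) (MI MP : {set V})
    (cI cP : V -> R) (p : dom_vars R V) : R :=
  \sum_(i in MI) cI i * xvar p i + \sum_(k in MP) cP k * zvar p k.

Definition is_binary (R : realType) (a : R) : Prop := a = 0 \/ a = 1.

Record dom_common (R : realType) (V : finType) (E : {set {set V}})
    (MI MP : {set V}) (p : dom_vars R V) : Prop := DomCommon {
  dom_cover : forall i : V,
    1 <= zvar p i + \sum_(k : V | [set i; k] \in E) zvar p k
         + \sum_(j : V) wvar p i j;
  dom_capacity : forall j : V, \sum_(i : V) wvar p i j <= xvar p j;
  dom_nonedge : forall i j : V,
    i != j -> [set i; j] \notin E -> wvar p i j = 0;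
  dom_monitor : 1 <= \sum_(k in MP) zvar p k;
  dom_x_out : forall i : V, i \notin MI -> xvar p i = 0;
  dom_z_out : forall k : V, k \notin MP -> zvar p k = 0;
  dom_z_binary : forall k : V, k \in MP -> is_binary (zvar p k)
}.

Definition DOM_feasible (R : realType) (V : finType) (E : {set {set V}})
    (MI MP : {set V}) (p : dom_vars R V) : Prop :=
  [/\ dom_common E MI MP p,
      forall i : V, i \in MI -> is_binary (xvar p i)
    & forall i j : V, is_binary (wvar p i j)].

Definition DOM_MIP_feasible (R : realType) (V : finType) (E : {set {set V}})
    (MI MP : {set V}) (p : dom_vars R V) : Prop :=
  [/\ dom_common E MI MP p,
      forall i : V, i \in MI -> 0 <= xvar p i <= 1
    & forall i j : V, 0 <= wvar p i j <= 1].

(* Value of a minimization problem as an extended real; +oo when there is no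
   feasible point. *)
Definition optimal_value (R : realType) (T : Type) (feasible : T -> Prop)
    (cost : T -> R) : \bar R :=
  ereal_inf [set (cost p)%:E | p in [set p : T | feasible p]]%classic.

(* Main.v *)
Require Import Defs.
From HB Require Import structures.
From mathcomp Require Import all_boot all_order all_algebra.
From mathcomp Require Import classical_sets reals constructive_ereal ereal.

Set Implicit Arguments.
Unset Strict Implicit.
Unset Printing Implicit Defensive.

Import Order.TTheory GRing.Theory Num.Theory.
Local Open Scope ring_scope.

(** Every feasible point of (DOM) is feasible for (DOM-MIP), so it suffices to
    turn a feasible point [(x, z, w)] of (DOM-MIP) into one of (DOM) that costs
    no more and has the same [z] ([DOM_MIP_rounding]).  The reason that this is
    possible is that, once [z] is fixed at binary values, what remains is a
    transportation problem, whose optimum is attained at integral points.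

    With [z] fixed, the coverage of a node by the [z]-variables is a natural
    number; the nodes for which it is [0] must be covered by [w].  For these
    nodes the row of [w] has sum at least [1] and is scaled down to sum [1];
    all other rows are replaced by [0].  One extra row, holding what is
    missing from each column to [1], turns the result into a nonnegative
    matrix with all column sums equal to [1] and integral row sums.
    [transportation_integral] replaces it by an integral, hence 0/1, matrix
    with the same row and column sums, with support inside the old support
    (so that [w] stays on the graph and on nodes where [x] may be positive) and without raising a given
    linear cost.  Finally, on [MI], [x_j] is set to [1] where its cost is
    negative, and to the new column sum elsewhere.

    The integrality lemma is proved by the usual perturbation argument.  In a
    matrix with integral row and column sums, a line with one non-integral
    entry has a second one.  Hence the set [F] of non-integral entries is so
    large that a nonzero perturbation supported on [F] has zero line sums
    ([zero_sum_direction]).  Moving along it, in the direction that does not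
    raise the cost, until an entry reaches [0] makes [F] smaller. *)

Lemma card_imset_half (T S : finType) (f : T -> S) (F : {set T}) :
  (forall p, p \in F -> exists2 q, q \in F & (q != p) && (f q == f p)) ->
  (#|f @: F|.*2 <= #|F|)%N.
Proof.
move=> F2; rewrite -[#|F|]sum1_card (partition_big_imset f) /= -muln2 -sum_nat_const.
apply: leq_sum => _ /imsetP[p pF ->]; have [q qF /andP[qp fq]] := F2 p pF.
by rewrite (bigD1 p) ?pF ?eqxx //= (bigD1 q) ?qF ?fq ?qp.
Qed.

(** Seen as the edge set of a bipartite graph on rows and columns, [F] has
    minimum degree two and so contains a cycle, along which [d] could alternate
    in sign.  The proof counts dimensions instead: the zero-sum conditions on
    the lines met by [F] are at most [#|F|] in number, because each of the two
    families has at most [#|F| / 2] members, and they are linearly dependent,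
    because both families add up to the sum over [F]. *)
Lemma zero_sum_direction (R : fieldType) (A B : finType) (F : {set A * B}) :
  F != finset.set0 ->
  (forall p, p \in F -> exists2 q, q \in F & (q != p) && (q.1 == p.1)) ->
  (forall p, p \in F -> exists2 q, q \in F & (q != p) && (q.2 == p.2)) ->
  exists d : A -> B -> R,
    [/\ exists a b, d a b != 0,
        forall a b, (a, b) \notin F -> d a b = 0,
        forall a, \sum_b d a b = 0
      & forall b, \sum_a d a b = 0].
Proof.
move=> /finset.set0Pn[p0 p0F] F1 F2.
have A2 := card_imset_half F1; have B2 := card_imset_half F2.
set A' := [set p.1 | p in F] in A2; set B' := [set p.2 | p in F] in B2.
pose M1 : 'M[R]_(#|F|, #|A'|) :=
  \matrix_(k, l) ((enum_val k).1 == enum_val l)%:R.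
pose M2 : 'M[R]_(#|F|, #|B'|) :=
  \matrix_(k, l) ((enum_val k).2 == enum_val l)%:R.
(* Column [l] of [M1] (of [M2]) is the indicator of the entries of [F] that
   lie on row (column) number [l] of the lines met by [F]. *)
have M1E : M1 *m const_mx 1 = const_mx 1 :> 'cV_#|F|.
  apply/colP => k; rewrite !mxE.
  have kA : (enum_val k).1 \in A' by apply: imset_f; apply: enum_valP.
  rewrite (bigD1 (enum_rank_in kA (enum_val k).1)) //= !mxE enum_rankK_in //.
  rewrite eqxx mulr1 big1 ?addr0 // => l lk; rewrite !mxE mulr1.
  suff /negPf-> : (enum_val k).1 != enum_val l by [].
  by apply: contra lk => /eqP kl; apply/eqP/enum_val_inj; rewrite enum_rankK_in.
have M2E : M2 *m const_mx 1 = const_mx 1 :> 'cV_#|F|.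
  apply/colP => k; rewrite !mxE.
  have kB : (enum_val k).2 \in B' by apply: imset_f; apply: enum_valP.
  rewrite (bigD1 (enum_rank_in kB (enum_val k).2)) //= !mxE enum_rankK_in //.
  rewrite eqxx mulr1 big1 ?addr0 // => l lk; rewrite !mxE mulr1.
  suff /negPf-> : (enum_val k).2 != enum_val l by [].
  by apply: contra lk => /eqP kl; apply/eqP/enum_val_inj; rewrite enum_rankK_in.
pose M := row_mx M1 M2.
have rkM : (\rank M < #|F|)%N.
  have ABF : (#|A'| + #|B'| <= #|F|)%N.
    by rewrite -leq_double doubleD -[#|F|.*2]addnn leq_add.
  rewrite (leq_trans _ ABF) // ltn_neqAle rank_leq_col andbT.
  (* The columns of [M1] and those of [M2] have the same sum, so [M] kills the
     nonzero vector with entries 1 on the former and -1 on the latter. *)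
  apply/negP => /row_fullP[N NM].
  have : M *m col_mx (const_mx 1) (- const_mx 1) = 0 :> 'cV_#|F|.
    by rewrite mul_row_col mulmxN M1E M2E subrr.
  move/(congr1 (mulmx N)); rewrite mulmxA NM mul1mx mulmx0 => /colP.
  have p0A : p0.1 \in A' by apply: imset_f.
  move=> /(_ (lshift _ (enum_rank_in p0A p0.1))).
  by rewrite col_mxEu !mxE => /eqP; rewrite oner_eq0.
have /rowV0Pn[v /sub_kermxP vM v0] : kermx M != 0.
  by rewrite kermx_eq0 /row_free neq_ltn rkM.
have {vM} [vM1 vM2] : v *m M1 = 0 /\ v *m M2 = 0.
  by move: vM; rewrite mul_mx_row -[X in _ = X]row_mx0 => /eq_row_mx.
(* The sum has at most one term: it extends [v] by zero outside [F]. *)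
exists (fun a b => \sum_(k | enum_val k == (a, b)) v 0 k); split.
- have /rV0Pn[k vk] := v0.
  exists (enum_val k).1, (enum_val k).2.
  rewrite (big_pred1 k) // => l; rewrite -surjective_pairing.
  by rewrite (inj_eq enum_val_inj).
- move=> a b abF; rewrite big_pred0 // => k; apply/eqP => kab.
  by rewrite -kab enum_valP in abF.
- move=> a.
  transitivity (\sum_(k | (enum_val k).1 == a) v 0 k).
    by rewrite [RHS](partition_big (fun k => (enum_val k).2) predT) //.
  have [aA|aA] := boolP (a \in A'); last first.
    rewrite big_pred0 // => k; apply/eqP => ka.
    by move: aA; rewrite -ka imset_f ?enum_valP.
  have /rowP/(_ (enum_rank_in aA a)) := vM1; rewrite !mxE => sumE; rewrite -[RHS]sumE.
  rewrite big_mkcond; apply: eq_bigr => k _; rewrite !mxE enum_rankK_in //.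
  by case: eqP; rewrite ?mulr1 ?mulr0.
- move=> b.
  transitivity (\sum_(k | (enum_val k).2 == b) v 0 k).
    rewrite [RHS](partition_big (fun k => (enum_val k).1) predT) //=.
    by apply: eq_bigr => a _; apply: eq_bigl => k; rewrite andbC -xpair_eqE -surjective_pairing.
  have [bB|bB] := boolP (b \in B'); last first.
    rewrite big_pred0 // => k; apply/eqP => kb.
    by move: bB; rewrite -kb imset_f ?enum_valP.
  have /rowP/(_ (enum_rank_in bB b)) := vM2; rewrite !mxE => sumE; rewrite -[RHS]sumE.
  rewrite big_mkcond; apply: eq_bigr => k _; rewrite !mxE enum_rankK_in //.
  by case: eqP; rewrite ?mulr1 ?mulr0.
Qed.

Lemma second_nonint (R : archiRealFieldType) (I : finType) (f : I -> R) i :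
  \sum_k f k \is a Num.int -> f i \isn't a Num.int ->
  exists2 k, k != i & f k \isn't a Num.int.
Proof.
move=> sf fi; apply/exists_inP; apply: contraNT fi => /exists_inPn fk.
have -> : f i = \sum_k f k - \sum_(k | k != i) f k by rewrite (bigD1 i) //= addrK.
by rewrite rpredB // rpred_sum // => k /fk; rewrite negbK.
Qed.

Definition mxcost (R : realType) (A B : finType) (c N : A -> B -> R) :=
  \sum_a \sum_b c a b * N a b.

(** Integrality of transportation polytopes, in a form that also keeps the
    support; by induction on the number of non-integral entries. *)
Lemma transportation_integral (R : realType) (A B : finType)
    (c N : A -> B -> R) :
  (forall a b, 0 <= N a b) ->
  (forall a, \sum_b N a b \is a Num.int) ->
  (forall b, \sum_a N a b \is a Num.int) ->
  exists N' : A -> B -> R,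
    [/\ forall a b, N' a b \is a Num.int /\ 0 <= N' a b,
        forall a, \sum_b N' a b = \sum_b N a b,
        forall b, \sum_a N' a b = \sum_a N a b,
        forall a b, N a b = 0 -> N' a b = 0
      & mxcost c N' <= mxcost c N].
Proof.
pose frac (N : A -> B -> R) := [set p | N p.1 p.2 \isn't a Num.int].
have [n] := ubnP #|frac N|; elim: n N => // n IHn N /ltnSE leFn N0 Nr Nc.
have [F0|Fn0] := eqVneq (frac N) finset.set0.
  exists N; split => // a b; split => //.
  by have := finset.in_set0 (a, b); rewrite -F0 inE => /negbFE.
have [p|p|d [[a0 [b0 d0]] dF dr dc]] := zero_sum_direction R Fn0.
- rewrite inE => /(second_nonint (Nr _))[b bp Nb].
  by exists (p.1, b); rewrite ?inE //= -pair_eqE /= eqxx bp.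
- rewrite inE => /(second_nonint (f := fun a => N a p.2) (Nc _))[a ap Na].
  by exists (a, p.2); rewrite ?inE //= -pair_eqE /= !eqxx !andbT ap.
wlog dcost : d d0 dF dr dc / mxcost c d <= 0.
  have [dcost H|dcost] := lerP (mxcost c d) 0; first exact: (H d).
  move/(_ (fun a b => - d a b)); apply.
  - by rewrite oppr_eq0.
  - by move=> a b /dF ->; rewrite oppr0.
  - by move=> a; rewrite sumrN dr oppr0.
  - by move=> b; rewrite sumrN dc oppr0.
  - rewrite /mxcost; under eq_bigr do under eq_bigr do rewrite mulrN.
    by under eq_bigr do rewrite sumrN; rewrite sumrN oppr_le0 ltW.
(* The sums of [d] vanish and [d] is nonzero, so both signs occur: the ratio
   test below ranges over a nonempty set. *)
have [p1 dp1] : exists p, d p.1 p.2 < 0.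
  apply/existsP; apply: contraNT d0 => /existsPn dge0.
  have /psumr_eq0P -> // := dr a0.
  by move=> b _; have := dge0 (a0, b); rewrite -leNgt.
pose ratio (p : A * B) := N p.1 p.2 / - d p.1 p.2.
have [p dp pmin] := @Order.TotalTheory.arg_minP _ _ _ p1 (fun p => d p.1 p.2 < 0) ratio dp1.
(* The largest step that keeps [N + t d] nonnegative; it sends entry [p] to 0. *)
pose t := ratio p.
have t0 : 0 <= t by rewrite divr_ge0 // oppr_ge0 ltW.
pose N1 a b := N a b + t * d a b.
have N1r a : \sum_b N1 a b = \sum_b N a b.
  by rewrite big_split /= -mulr_sumr dr mulr0 addr0.
have N1c b : \sum_a N1 a b = \sum_a N a b.
  by rewrite big_split /= -mulr_sumr dc mulr0 addr0.
have N1z a b : N a b \is a Num.int -> N1 a b = N a b.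
  by move=> Nab; rewrite /N1 dF ?mulr0 ?addr0 // inE /= Nab.
have N1cost : mxcost c N1 <= mxcost c N.
  have -> : mxcost c N1 = mxcost c N + t * mxcost c d.
    rewrite /mxcost mulr_sumr -big_split; apply: eq_bigr => a _ /=.
    rewrite mulr_sumr -big_split; apply: eq_bigr => b _ /=.
    by rewrite mulrDr mulrCA.
  by rewrite gerDl mulr_ge0_le0.
have [||||N' [N'i N'r N'c N'z N'cost]] := IHn N1.
- apply: leq_trans leFn; apply: proper_card; apply/properP; split.
    apply/fintype.subsetP => q; rewrite !inE; apply: contra => Nq.
    by rewrite N1z.
  exists p.
    by apply: contraTT dp => pF; rewrite dF -?surjective_pairing ?ltxx.
  rewrite inE negbK /N1 /t /ratio invrN mulrN mulNr divfK ?subrr //.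
  by rewrite lt_eqF.
- move=> a b; rewrite /N1; have [dab|dab] := ltP (d a b) 0; last first.
    by rewrite addr_ge0 // mulr_ge0.
  have := pmin (a, b) dab; rewrite /ratio /= -/(ratio p) -/t.
  by rewrite ler_pdivlMr ?oppr_gt0 // mulrN -subr_ge0 opprK.
- by move=> a; rewrite N1r.
- by move=> b; rewrite N1c.
exists N'; split => //.
- by move=> a; rewrite N'r.
- by move=> b; rewrite N'c.
- by move=> a b Nab; rewrite N'z // N1z Nab.
- exact: le_trans N1cost.
Qed.

Lemma int_binary (R : realType) (a : R) :
  a \is a Num.int -> 0 <= a -> a <= 1 -> is_binary a.
Proof.
move=> ai a0 a1; have /natrP[n an] : a \is a Num.nat by rewrite natrEint ai.
move: a1; rewrite an (ler_nat _ n 1) /is_binary.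
by case: n {an} => [|[|]] // _; [left|right].
Qed.

Lemma binary_itv (R : realType) (a : R) : is_binary a -> 0 <= a <= 1.
Proof. by case=> ->; rewrite ?lexx ?ler01. Qed.

Lemma binary_int (R : realType) (a : R) : is_binary a -> a \is a Num.int.
Proof. by case=> ->; rewrite ?rpred0 ?rpred1. Qed.

Lemma DOM_MIP_of_DOM (R : realType) (V : finType) (E : {set {set V}})
    (MI MP : {set V}) (p : dom_vars R V) :
  DOM_feasible E MI MP p -> DOM_MIP_feasible E MI MP p.
Proof.
by case=> pc px pw; split => // [i /px|i j]; exact: binary_itv.
Qed.

(** The rounded point keeps [z]; its [w] is the nonextra part of an integral
    point of the transportation problem, and its [x] is the cheapest one
    compatible with that [w]. *)
Lemma DOM_MIP_rounding (R : realType) (V : finType) (E : {set {set V}})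
    (MI MP : {set V}) (cI cP : V -> R) (p : dom_vars R V) :
  DOM_MIP_feasible E MI MP p ->
  exists2 q : dom_vars R V, DOM_feasible E MI MP q &
    dom_cost MI MP cI cP q <= dom_cost MI MP cI cP p.
Proof.
case: p => x z w [[/= cover cap nonedge monitor xout zout zbin] /= x01 w01].
have w0 i j : 0 <= w i j by case/andP: (w01 i j).
have x1 j : x j <= 1.
  have [/x01/andP[]//|/xout ->] := boolP (j \in MI); exact: ler01.
have zb k : is_binary (z k).
  by have [/zbin//|/zout ->] := boolP (k \in MP); left.
pose zcov i := z i + \sum_(k | [set i; k] \in E) z k.
have zcov0 i : 0 <= zcov i.
  have z0 k : 0 <= z k by case/andP: (binary_itv (zb k)).
  by rewrite addr_ge0 ?sumr_ge0.
pose rs i := \sum_j w i j.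
have rs0 i : 0 <= rs i by apply: sumr_ge0.
have zcov_small i : zcov i < 1 -> 1 <= rs i.
  move=> zi.
  have zii : zcov i \is a Num.int.
    by rewrite rpredD ?rpred_sum // => [|k _]; exact: binary_int.
  case: (int_binary zii (zcov0 i) (ltW zi)) => z1; last by rewrite z1 ltxx in zi.
  by have := cover i; rewrite -/(zcov i) z1 add0r.
pose nw i j := if zcov i < 1 then w i j / rs i else 0.
have nw0 i j : 0 <= nw i j by rewrite /nw; case: ifP => // _; exact: divr_ge0.
have nww i j : nw i j <= w i j.
  rewrite /nw; case: ifP => // /zcov_small rsi.
  by rewrite ler_pdivrMr ?(lt_le_trans ltr01) // ler_peMr.
have nwx j : \sum_i nw i j <= x j.
  by apply: le_trans (cap j); apply: ler_sum.
(* The rows are the nodes, and [None] is the row of column deficits. *)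
pose N (a : option V) j := if a is Some i then nw i j else 1 - \sum_i nw i j.
have optE (f : option V -> R) : \sum_a f a = f None + \sum_i f (Some i).
  rewrite (bigD1 None) //=; congr (_ + _).
  rewrite (reindex_omap Some id) /=; last by case.
  by apply: eq_bigl => i; rewrite eqxx.
have Nr1 i : \sum_j N (Some i) j = (zcov i < 1)%R%:R.
  rewrite /= /nw; have [/zcov_small rsi|_] := ltP (zcov i) 1; last by rewrite big1.
  by rewrite -mulr_suml divff // gt_eqF // (lt_le_trans ltr01).
have Nc j : \sum_a N a j = 1 by rewrite optE /= subrK.
(* The positive part of [cI] is charged to the column sums of [w].  Its
   negative part is paid in full by opening the node, which no fractional [x]
   improves on, so it does not enter the transportation problem. *)
pose c (a : option V) j :=
  if a is Some i then (if j \in MI then Num.max (cI j) 0 else 0) else 0.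
have [|||N' [N'i N'r N'c N'z N'cost]] := @transportation_integral _ _ _ c N.
- by case=> [i|] j //=; rewrite subr_ge0 (le_trans (nwx j)).
- case=> [i|]; first by rewrite Nr1 rpred_nat.
  rewrite /= sumrB rpredB //; first by rewrite rpred_sum // rpred1.
  by rewrite exchange_big rpred_sum // => i _; rewrite -/(N (Some i)) Nr1 rpred_nat.
- by move=> j; rewrite Nc rpred1.
have N'0 a j : 0 <= N' a j by case: (N'i a j).
have N'1 a j : N' a j <= 1.
  by rewrite -(Nc j) -N'c (bigD1 a) //= lerDl sumr_ge0.
have N'b a j : is_binary (N' a j) by apply: int_binary => //; case: (N'i a j).
have W1 j : \sum_i N' (Some i) j = 1 - N' None j.
  by rewrite -(Nc j) -N'c optE addrC addKr.
pose X j := if j \in MI then if cI j < 0 then 1 else \sum_i N' (Some i) j else 0.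
have Wout i j : w i j = 0 -> N' (Some i) j = 0.
  by move=> wij; apply: N'z; rewrite /= /nw wij mul0r if_same.
exists (DomVars X z (fun i j => N' (Some i) j)).
  split => /=; [split => //= | | ].
  - move=> i; rewrite -/(zcov i) N'r Nr1.
    by have [_|zi] := ltP (zcov i) 1; rewrite ?addr0 // lerDr.
  - move=> j; rewrite /X; case: ifP => jMI; last first.
      (* Capacity [x j = 0] forces column [j] of [w] to vanish, and rounding
         keeps zeros. *)
      rewrite big1 // => i _; apply: Wout; apply/eqP.
      rewrite eq_le w0 andbT -(xout j) ?jMI // (le_trans _ (cap j)) //.
      by rewrite (bigD1 i) //= lerDl sumr_ge0.
    by case: ifP => // _; rewrite W1 gerBl.
  - by move=> i j ij ijE; apply: Wout; apply: nonedge.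
  - by move=> i /negPf iMI; rewrite /X iMI.
  - move=> j jMI; rewrite /X jMI; case: ifP => _; first by right.
    by rewrite W1; case: (N'b None j) => ->; rewrite ?subr0 ?subrr; [right|left].
  - by move=> i j; exact: N'b.
rewrite /dom_cost lerD2r /=.
have costE (M : option V -> V -> R) :
    mxcost c M = \sum_(j in MI) Num.max (cI j) 0 * \sum_i M (Some i) j.
  rewrite /mxcost optE /= big1 ?add0r => [|j _]; last by rewrite mul0r.
  rewrite exchange_big [RHS]big_mkcond; apply: eq_bigr => j _ /=.
  rewrite mulr_sumr; case: ifP => _ //.
  by rewrite big1 // => i _; rewrite mul0r.
have splitE (y : V -> R) : \sum_(j in MI) cI j * y j =
   \sum_(j in MI) Num.max (cI j) 0 * y j + \sum_(j in MI) Num.min (cI j) 0 * y j.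
  by rewrite -big_split; apply: eq_bigr => j _ /=; rewrite -mulrDl addr_max_min addr0.
rewrite !splitE lerD //.
  have -> : \sum_(j in MI) Num.max (cI j) 0 * X j = mxcost c N'.
    rewrite costE; apply: eq_bigr => j jMI; rewrite /X jMI.
    by case: ltP => //; rewrite !mul0r.
  apply: (le_trans N'cost); rewrite costE; apply: ler_sum => j _.
  by rewrite ler_wpM2l ?nwx // le_max lexx orbT.
apply: ler_sum => j jMI; rewrite /X jMI; case: ltP => cj; last by rewrite !mul0r.
by rewrite mulr1 ler_nMr.
Qed.

Theorem mainTheorem7 (R : realType) (V : finType) (E : {set {set V}})
    (MI MP : {set V}) (cI cP : V -> R) (HE : connected_graph E) :
  ((exists p : dom_vars R V, DOM_feasible E MI MP p) <->
   (exists p : dom_vars R V, DOM_MIP_feasible E MI MP p)) /\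
  optimal_value (DOM_feasible E MI MP) (dom_cost MI MP cI cP) =
  optimal_value (DOM_MIP_feasible E MI MP) (dom_cost MI MP cI cP).
Proof.
split.
  split=> [[p /DOM_MIP_of_DOM pf]|[p /(DOM_MIP_rounding cI cP)[q qf _]]].
    by exists p.
  by exists q.
apply/eqP; rewrite eq_le /optimal_value; apply/andP; split.
  apply/ereal_infP => _ [p /= /(DOM_MIP_rounding cI cP)[q qf qp] <-].
  by apply: ge_ereal_inf; exists (dom_cost MI MP cI cP q)%:E; [exists q | rewrite lee_fin].
apply/ereal_infP => _ [p /= /DOM_MIP_of_DOM pf <-].
by apply: ereal_inf_lbound; exists p.
Qed.
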